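(* Let $X_n\in\mathbb R^{n\times p}$ be a random matrix with i.i.d. entries distributed as $\mathcal N(0,1)$. Then, for any $r>0$, there exist (explicitly known) constants $\tilde c_1(r),\tilde c_2(r)>0$ such that $$\mathbb E\big[(s_{\max}(X_n))^r\big]\le\tilde c_1(r)(\sqrt n+\sqrt p)^r+\tilde c_2(r).$$ Moreover, if $p/n\to\gamma\in[0,\infty)$, then there exists a universal constant $K_3(r)>0$ (depending only on $r$ and $\gamma$) such that $$\mathbb E\left[\left(\frac{s_{\max}(X_n)}{\sqrt n}\right)^r\right]\le K_3(r).$$
   Context: $s_{\max}(A)$ denotes the largest singular value of a matrix $A$. In the last claim $p=p_n$ may depend on $n$ and the limit is taken as $n\to\infty$.
   Formalization: The second bound is stated for all sufficiently large n, with K_3 depending only on r and γ; for every n it fails, since p_1 can be arbitrarily large without affecting the limit of p/n. The ''explicitly known'' constants are asserted to exist, depending on r only. *)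

(* Defs.v *)
From HB Require Import structures.
From mathcomp Require Import all_boot all_order all_algebra.
From mathcomp Require Import all_classical all_reals all_analysis.

Set Implicit Arguments.
Unset Strict Implicit.
Unset Printing Implicit Defensive.

Import Order.TTheory GRing.Theory Num.Theory.
Import numFieldNormedType.Exports.

Local Open Scope classical_set_scope.
Local Open Scope ring_scope.

(* When n < p this set may contain an additional 0 with respect to the
   convention of min(n, p) singular values; the largest element is the same. *)
Definition singular_values (R : realType) (n p : nat) (A : 'M[R]_(n, p)) :
    set R :=
  [set Num.sqrt l | l in [set l : R | eigenvalue (A^T *m A) l]].

(* The set of singular values is finite, so that its supremum is its maximum;
   for p = 0 it is empty, and then s_max A = sup set0 = 0. *)
Definition s_max (R : realType) (n p : nat) (A : 'M[R]_(n, p)) : R :=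
  sup (singular_values A).

Definition mutually_independent (R : realType) (d : measure_display)
    (T : measurableType d) (P : probability T R) (I : finType)
    (X : I -> {RV P >-> R}) : Prop :=
  forall (J : {set I}) (B : I -> set R), (forall i, measurable (B i)) ->
    P (\bigcap_(i in [set` J]) (X i @^-1` B i)) =
    (\prod_(i in J) P (X i @^-1` B i))%E.

(* The laws are compared on measurable sets only: [distribution] and
   [normal_prob] are total functions, whose values on other sets are junk. *)
Definition has_law_normal (R : realType) (d : measure_display)
    (T : measurableType d) (P : probability T R) (X : {RV P >-> R})
    (m s : R) : Prop :=
  forall B : set R, measurable B -> distribution P X B = normal_prob m s B.

Definition iid_std_normal_entries (R : realType) (d : measure_display)
    (T : measurableType d) (P : probability T R) (n p : nat)
    (X : 'I_n -> 'I_p -> {RV P >-> R}) : Prop :=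
  mutually_independent (fun ij : 'I_n * 'I_p => X ij.1 ij.2) /\
  (forall i j, has_law_normal (X i j) 0 1).

Definition random_matrix (R : realType) (d : measure_display)
    (T : measurableType d) (P : probability T R) (n p : nat)
    (X : 'I_n -> 'I_p -> {RV P >-> R}) (w : T) : 'M[R]_(n, p) :=
  \matrix_(i, j) X i j w.

(* Main.v *)
Require Import Defs.
From HB Require Import structures.
From mathcomp Require Import all_boot all_order all_algebra.
From mathcomp Require Import all_classical all_reals all_analysis.
From mathcomp Require Import measurable_realfun ring lra.

Set Implicit Arguments.
Unset Strict Implicit.
Unset Printing Implicit Defensive.

Import Order.TTheory GRing.Theory Num.Theory.
Import numFieldNormedType.Exports.

Local Open Scope classical_set_scope.
Local Open Scope ring_scope.

(** Write lam = sqrt (n + p) and let A be an n x p matrix. The largest singular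
value is a maximum of the bilinear form u A v over unit vectors, and a bilinear
form over a box is at least as large at a suitable vertex as at a given point of
the box. Hence, after scaling u by sqrt n and v by sqrt p, both vectors can be
rounded coordinate by coordinate to integer vectors z, t without decreasing the
form; rounding costs at most a constant per coordinate, so that z and t still
have squared norms at most 4 n and 4 p ([exists_rounding_bilinear]). This
replaces an epsilon-net of the spheres, and [expR_s_max_le] turns it into
  exp (lam * s_max A) <= Phi,
where Phi is the sum of exp (lam / sqrt (n p) * z A t) over all pairs of such
lattice points.

For a Gaussian matrix each summand has expectation
exp (lam^2 |z|^2 |t|^2 / (2 n p)) <= exp (8 lam^2), because independence turns
the expectation of a product into a product ([independent_integral_prod]) and
each factor is a Gaussian moment generating function ([normal_mgf]). There are
at most exp (6 n) exp (6 p) pairs ([card_lattice_ball]), so that the expectation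
of Phi is at most exp (14 lam^2): the entropy of the lattice balls and the
Gaussian tail are of the same order.

It remains to pass from this exponential moment to the r-th moment. As
x^r <= r^r e^x, and e^y <= 1 + e^(lam^2 y) when lam >= 1, the power s^r is at
most a constant times lam^r (1 + exp (lam s - 14 lam^2))
([powR_le_expR_sqr]), which has expectation at most 2 constant lam^r. This is
[expectation_s_max_powR_le]. Both claims follow: lam <= sqrt n + sqrt p, and
lam / sqrt n <= sqrt (gamma + 2) as soon as p / n <= gamma + 1.

The map w |-> s_max (random_matrix X w) is bounded pointwise by measurable
functions, and the bound passes to integrals because the integral of a
nonnegative function is defined as a supremum over the simple functions below it
([ge0_le_integral_nonmeasurable]). *)

(** * Integrals determined by the values on indicators *)

Section change_of_law.
Import HBNNSimple.
Local Open Scope ereal_scope.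

Lemma integral_weighted_nnsfun (R : realType) (d d' : measure_display)
    (T : measurableType d) (Y : measurableType d')
    (mu : {measure set T -> \bar R}) (phi : T -> Y) (g : T -> \bar R)
    (h : {nnsfun Y >-> R}) :
    measurable_fun [set: T] phi -> measurable_fun [set: T] g ->
    (forall x, 0 <= g x) ->
  \int[mu]_x (g x * (h (phi x))%:E) =
  \sum_(y \in range h)
     y%:E * \int[mu]_x (g x * (\1_(h @^-1` [set y]) (phi x))%:E).
Proof.
move=> mphi mg g0.
have mi y : measurable_fun [set: T]
    (fun x => (\1_(h @^-1` [set y]) (phi x))%:E : \bar R).
  apply/measurable_EFinP; apply: (measurableT_comp _ mphi).
  exact: measurable_indic.
have mgi y : measurable_fun [set: T]
    (fun x => g x * (\1_(h @^-1` [set y]) (phi x))%:E).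
  by apply: emeasurable_funM.
transitivity (\int[mu]_x (\sum_(y \in range h)
    (y%:E * (g x * (\1_(h @^-1` [set y]) (phi x))%:E)))).
  apply: eq_integral => x _; rewrite fimfunE -fsumEFin// ge0_mule_fsumr.
    by apply: eq_fsbigr => y _; rewrite EFinM muleCA.
  by move=> y; rewrite EFinM; exact: nnfun_muleindic_ge0.
rewrite ge0_integral_fsum//.
- apply: eq_fsbigr => y /[!inE] -[z _ <-].
  by rewrite ge0_integralZl// ?lee_fin// => x _; rewrite mule_ge0.
- by move=> y; apply: emeasurable_funM.
- by move=> y x _; rewrite muleCA mule_ge0//; exact: nnfun_muleindic_ge0.
Qed.

(** Two weighted laws that agree on indicators agree on simple functions, hence
on their monotone limits. The two spaces may differ, for the sake of two
applications: in [independent_integral_prod] the weight is a function of the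
other random variables and is compared with its mean, and in [normal_mgf] the
law of a random variable is compared with a density on the line. The weights are
finite so that multiplication by them commutes with limits. *)
Lemma integral_weighted_eq (R : realType) (d1 d2 d : measure_display)
    (T1 : measurableType d1) (T2 : measurableType d2) (Y : measurableType d)
    (mu1 : {measure set T1 -> \bar R}) (mu2 : {measure set T2 -> \bar R})
    (phi1 : T1 -> Y) (phi2 : T2 -> Y) (g1 : T1 -> \bar R) (g2 : T2 -> \bar R)
    (f : Y -> R) :
    measurable_fun [set: T1] phi1 -> measurable_fun [set: T2] phi2 ->
    measurable_fun [set: T1] g1 -> measurable_fun [set: T2] g2 ->
    (forall x, 0 <= g1 x) -> (forall x, 0 <= g2 x) ->
    (forall x, g1 x \is a fin_num) -> (forall x, g2 x \is a fin_num) ->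
    (forall B, measurable B ->
      \int[mu1]_x (g1 x * (\1_B (phi1 x))%:E) =
      \int[mu2]_x (g2 x * (\1_B (phi2 x))%:E)) ->
    measurable_fun [set: Y] f -> (forall y, (0 <= f y)%R) ->
  \int[mu1]_x (g1 x * (f (phi1 x))%:E) = \int[mu2]_x (g2 x * (f (phi2 x))%:E).
Proof.
move=> mphi1 mphi2 mg1 mg2 g10 g20 g1fin g2fin eqB mf f0.
have mEf : measurable_fun [set: Y] (EFin \o f) by exact/measurable_EFinP.
pose h := nnsfun_approx measurableT mEf.
have limE d' (T : measurableType d') (mu : {measure set T -> \bar R})
    (phi : T -> Y) (g : T -> \bar R) : measurable_fun [set: T] phi ->
    measurable_fun [set: T] g -> (forall x, 0 <= g x) ->
    (forall x, g x \is a fin_num) ->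
    \int[mu]_x (g x * (f (phi x))%:E) =
    limn (fun n => \int[mu]_x (g x * (h n (phi x))%:E)).
  move=> mphi mg g0 gfin; rewrite -monotone_convergence//.
  - apply: eq_integral => x _; apply/esym/cvg_lim => //.
    apply: (cvgeZl (gfin x)); apply: cvg_nnsfun_approx => //= y _.
    by rewrite lee_fin f0.
  - move=> n; apply: emeasurable_funM => //; apply/measurable_EFinP.
    exact: measurableT_comp.
  - by move=> n x _; rewrite mule_ge0// lee_fin.
  - move=> x _ m n mn; rewrite lee_wpmul2l// lee_fin.
    exact/lefP/nd_nnsfun_approx.
rewrite !limE//; congr (limn _); apply/funext => n.
rewrite !integral_weighted_nnsfun//.
by apply: eq_fsbigr => y _; rewrite eqB.
Qed.

(** Simple functions below f lie below g, whether or not f is measurable. *)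
Lemma ge0_le_integral_nonmeasurable (R : realType) (d : measure_display)
    (T : measurableType d) (mu : {measure set T -> \bar R})
    (f g : T -> \bar R) :
    (forall x, 0 <= f x) -> (forall x, f x <= g x) ->
  \int[mu]_x f x <= \int[mu]_x g x.
Proof.
move=> f0 fg; have g0 x : 0 <= g x by apply: le_trans (fg x).
rewrite !ge0_integralTE//; apply: le_ereal_sup => _ [h /= hf <-].
by exists h => //= x; exact: le_trans (fg x).
Qed.
End change_of_law.

(** * Independence and Gaussian moment generating functions *)

Section independence.
Context (R : realType) (d : measure_display) (T : measurableType d).
Context (P : probability T R).
Local Open Scope ereal_scope.

(** The product rule holds by definition when all the f i are indicators.
Indicators are then replaced by arbitrary functions one index at a time: for
fixed functions at the other indices, both sides of the identity depend on f k
as integrals do, so that agreement on indicators suffices. *)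
Lemma independent_integral_prod (I : finType) (X : I -> {RV P >-> R})
    (f : I -> R -> R) :
    mutually_independent X ->
    (forall i, measurable_fun [set: R] (f i)) -> (forall i x, (0 <= f i x)%R) ->
    (forall i, \int[P]_w (f i (X i w))%:E \is a fin_num) ->
  \int[P]_w (\prod_(i : I) f i (X i w))%:E =
  \prod_(i : I) \int[P]_w (f i (X i w))%:E.
Proof.
move=> indX.
(* s lists the indices at which f i may differ from an indicator. *)
suff H (s : seq I) : forall f : I -> R -> R,
    (forall i, measurable_fun [set: R] (f i)) ->
    (forall i x, (0 <= f i x)%R) ->
    (forall i, \int[P]_w (f i (X i w))%:E \is a fin_num) ->
    (forall i, i \notin s -> exists2 B : set R, measurable B & f i = \1_B) ->
    \int[P]_w (\prod_(i : I) f i (X i w))%:E =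
    \prod_(i : I) \int[P]_w (f i (X i w))%:E.
  by move=> mf f0 ffin; apply: (H (enum I)) => // i; rewrite mem_enum.
elim: s => [|k s IH] {}f mf f0 ffin fB.
  have /choice[B HB] i : exists B : set R, measurable B /\ f i = \1_B.
    by have [//|B mB fE] := fB i; exists B.
  have mXB i : measurable (X i @^-1` B i).
    by rewrite -[_ @^-1` _]setTI; apply: measurable_funP => //; case: (HB i).
  transitivity (\int[P]_w (\1_(\bigcap_(i in [set` [set: I]%SET])
      (X i @^-1` B i)) w)%:E).
    apply: eq_integral => w _; congr EFin; rewrite indicE.
    have [win|wout] := pselect (forall i, B i (X i w)).
      rewrite mem_set; last by move=> i _; exact: win.
      rewrite big1// => i _; have [_ ->] := HB i.
      by rewrite indicE mem_set//; exact: win.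
    rewrite memNset; last first.
      by move=> H; apply: wout => i; apply: H => /=; rewrite inE.
    have /existsNP[i Bi] := wout.
    rewrite (bigD1 i)//=; have [_ ->] := HB i.
    by rewrite indicE memNset// mul0r.
  rewrite integral_indic//; last first.
    apply: fin_bigcap_measurable => [|i _]; [exact: finite_finset|exact: mXB].
  rewrite setIT; etransitivity.
    by apply: (indX [set: I]%SET B) => i; case: (HB i).
  apply: eq_big => [i|i _]; first by rewrite inE.
  have [_ ->] := HB i.
  by rewrite -(setIT (X i @^-1` B i)) -integral_indic.
have mF i : measurable_fun [set: T] (fun w => f i (X i w)).
  exact: measurableT_comp.
pose g w := (\prod_(i | i != k) f i (X i w))%:E.
have mg : measurable_fun [set: T] g.
  apply/measurable_EFinP; under eq_fun do rewrite -big_filter.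
  exact: measurable_prod.
have g0 w : 0 <= g w by rewrite lee_fin prodr_ge0.
pose c := \prod_(i | i != k) \int[P]_w (f i (X i w))%:E.
have c0 : 0 <= c.
  by apply: prode_ge0 => i _; apply: integral_ge0 => w _; rewrite lee_fin.
transitivity (\int[P]_w (g w * (f k (X k w))%:E)).
  by apply: eq_integral => w _; rewrite (bigD1 k)//= muleC -EFinM.
rewrite (@integral_weighted_eq _ _ _ _ _ _ _ P P (X k) (X k) g (cst c))//;
  last first.
- move=> B mB.
  have mIB : measurable_fun [set: T] (fun w => (\1_B (X k w))%:E : \bar R).
    by apply/measurable_EFinP; apply: measurableT_comp.
  rewrite ge0_integralZl//.
  pose f' i := if i == k then \1_B else f i.
  have mf' i : measurable_fun [set: R] (f' i).
    by rewrite /f'; case: eqP => // _; exact: measurable_indic.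
  have f'0 i x : (0 <= f' i x)%R by rewrite /f'; case: eqP.
  have f'fin i : \int[P]_w (f' i (X i w))%:E \is a fin_num.
    rewrite /f'; case: eqP => // ->.
    rewrite (_ : (fun w => _) = (fun w => (\1_(X k @^-1` B) w)%:E))//.
    by rewrite integral_indic ?setIT ?fin_num_measure//;
      rewrite -[_ @^-1` _]setTI; exact: measurable_funP.
  have f'B i : i \notin s -> exists2 B : set R, measurable B & f' i = \1_B.
    move=> si; rewrite /f'; case: eqP => [_|/eqP ik]; first by exists B.
    by apply: fB; rewrite inE negb_or ik.
  have f'E i : i != k -> f' i = f i by rewrite /f' => /negbTE ->.
  have f'k : f' k = \1_B by rewrite /f' eqxx.
  have := IH f' mf' f'0 f'fin f'B; rewrite [in RHS](bigD1 k)//= muleC.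
  rewrite f'k (eq_bigr _ (fun i ik => congr1
    (fun h => \int[P]_w (h (X i w))%:E) (f'E i ik))) => <-.
  apply: eq_integral => w _; rewrite (bigD1 k)//= f'k mulrC EFinM.
  by congr (_%:E * _); apply: eq_bigr => i ik; rewrite f'E.
- by move=> w; exact: prode_fin_num.
rewrite ge0_integralZl//; last first.
- by move=> w _; rewrite lee_fin.
- exact/measurable_EFinP.
by rewrite (bigD1 k)//= muleC.
Qed.

(** Completing the square turns e^(a x) times the standard density into
e^(a^2/2) times the density of mean a, which integrates to 1. *)
Lemma normal_mgf (X : {RV P >-> R}) (a : R) : has_law_normal X 0 1 ->
  \int[P]_w (expR (a * X w))%:E = (expR (a ^+ 2 / 2))%:E.
Proof.
move=> lawX.
have mpdf m : measurable_fun [set: R] (EFin \o normal_pdf m 1).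
  by apply/measurable_EFinP; exact: measurable_normal_pdf.
transitivity (\int[P]_w (1 * (expR (a * X w))%:E)).
  by apply: eq_integral => w _; rewrite mul1e.
rewrite (@integral_weighted_eq _ _ _ _ _ _ _ P lebesgue_measure X
   id (cst 1) (EFin \o normal_pdf 0 1) (fun x => expR (a * x)%R))//;
  last 4 first.
- exact: mpdf.
- by move=> x; rewrite lee_fin normal_pdf_ge0.
- move=> B mB; have := lawX B mB.
  rewrite /distribution /= /pushforward /normal_prob => lawB.
  under eq_integral do rewrite mul1e.
  rewrite (_ : (fun x => _) = (fun w => (\1_(X @^-1` B) w)%:E))//.
  rewrite integral_indic//; last first.
    by rewrite -[_ @^-1` _]setTI; exact: measurable_funP.
  rewrite setIT; apply: (eq_trans lawB); rewrite integral_mkcond.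
  by apply: eq_integral => x _; rewrite epatch_indic.
- apply: measurableT_comp => //; exact: measurable_funM.
transitivity (\int[lebesgue_measure]_(x in [set: R])
   ((expR (a ^+ 2 / 2))%:E * (normal_pdf a 1 x)%:E)); last first.
  rewrite ge0_integralZl//.
  - by rewrite integral_normal_pdf mule1.
  - exact: mpdf.
  - by move=> x _; rewrite lee_fin normal_pdf_ge0.
apply: eq_integral => x _; rewrite /= -!EFinM; congr EFin.
rewrite !normal_pdfE ?oner_eq0// /normal_fun -mulrA [RHS]mulrCA -!expRD.
by congr (_ * expR _)%R; field.
Qed.
End independence.

(** * Rounding the maximizers of a bilinear form to integer vectors *)

Section rounding.
Context (R : realType).

(** Integers encoded as sign and absolute value: with a bounded absolute value
they form a finite type, and their sums split over the two signs. *)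
Definition signed_nat (k : bool * nat) : R := (-1) ^+ k.1 * k.2%:R.

(** A linear function of x does not decrease when x moves to a suitable one of
its two neighbouring integers, whose absolute values are at most |x| + 1. *)
Lemma exists_rounding (a x : R) : exists k : bool * nat,
  a * x <= a * signed_nat k /\ signed_nat k ^+ 2 <= 2 * x ^+ 2 + 2.
Proof.
suff pos (b y : R) : 0 <= y ->
    exists m : nat, b * y <= b * m%:R /\ m%:R ^+ 2 <= 2 * y ^+ 2 + 2 :> R.
  have [x0|x0] := leP 0 x.
    have [m [am m2]] := pos a x x0.
    by exists (false, m); rewrite /signed_nat mul1r.
  have nx0 : 0 <= - x by lra.
  have [m [am m2]] := pos (- a) (- x) nx0.
  exists (true, m); rewrite /signed_nat /= expr1 mulN1r sqrrN.
  split; last by move: m2; rewrite sqrrN.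
  by move: am; rewrite mulrNN mulrN mulNr.
move=> y0; have /andP[my ym] := truncn_itv y0.
set m := Num.truncn y in my ym; rewrite -natr1 in ym.
have m0 : 0 <= m%:R :> R by [].
have [b0|b0] := leP 0 b.
  exists m.+1; rewrite -natr1; split; first by rewrite ler_wpM2l// ltW.
  have : 0 <= (y - m%:R) * (y + m%:R + 2) by rewrite mulr_ge0//; lra.
  by have := sqr_ge0 (y - 1); lra.
exists m; split; first by rewrite ler_wnM2l// ltW.
have : 0 <= (y - m%:R) * (y + m%:R) by rewrite mulr_ge0//; lra.
by have := sqr_ge0 y; lra.
Qed.

Lemma exists_rounding_vec (n : nat) (a x : 'I_n -> R) :
    \sum_i x i ^+ 2 = n%:R ->
  exists z : 'I_n -> bool * nat,
    \sum_i a i * x i <= \sum_i a i * signed_nat (z i) /\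
    \sum_i signed_nat (z i) ^+ 2 <= 4 * n%:R.
Proof.
move=> x2.
have /choice[z Hz] i := exists_rounding (a i) (x i).
exists z; split; first by apply: ler_sum => i _; case: (Hz i).
apply: (@le_trans _ _ (\sum_(i < n) (2 * x i ^+ 2 + 2))).
  by apply: ler_sum => i _; case: (Hz i).
by rewrite big_split/= -mulr_sumr x2 sumr_const card_ord -mulr_natr; lra.
Qed.

(** With x fixed the form is linear in y, and with the rounded y fixed it is
linear in x: rounding one vector after the other never decreases the form. *)
Lemma exists_rounding_bilinear (n p : nat) (A : 'M[R]_(n, p))
    (x : 'I_n -> R) (y : 'I_p -> R) :
    \sum_i x i ^+ 2 = n%:R -> \sum_j y j ^+ 2 = p%:R ->
  exists (z : 'I_n -> bool * nat) (t : 'I_p -> bool * nat),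
    [/\ \sum_i \sum_j x i * A i j * y j <=
          \sum_i \sum_j signed_nat (z i) * A i j * signed_nat (t j),
        \sum_i signed_nat (z i) ^+ 2 <= 4 * n%:R &
        \sum_j signed_nat (t j) ^+ 2 <= 4 * p%:R].
Proof.
move=> x2 y2.
have [t [yt t2]] := exists_rounding_vec (fun j => \sum_i x i * A i j) y2.
have [z [xz z2]] :=
  exists_rounding_vec (fun i => \sum_j A i j * signed_nat (t j)) x2.
exists z, t; split => //.
have -> : \sum_i \sum_j x i * A i j * y j = \sum_j (\sum_i x i * A i j) * y j.
  by rewrite exchange_big; apply: eq_bigr => j _; rewrite mulr_suml.
apply: le_trans yt _.
rewrite [leLHS](_ : _ = \sum_i (\sum_j A i j * signed_nat (t j)) * x i).
  apply: le_trans xz _; apply: ler_sum => i _.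
  by rewrite mulr_suml; apply: ler_sum => j _; rewrite mulrC mulrA.
under eq_bigr do rewrite mulr_suml; rewrite exchange_big.
apply: eq_bigr => i _; rewrite mulr_suml.
by apply: eq_bigr => j _; ring.
Qed.

(** If v is an eigenvector of A^T A then v A^T is a left singular vector; the
unit vectors proportional to both realize the singular value. *)
Lemma eigenvalue_gram_vectors (n p : nat) (A : 'M[R]_(n, p)) (l : R) :
    0 < l -> eigenvalue (A^T *m A) l ->
  exists (u : 'I_n -> R) (v : 'I_p -> R),
    [/\ \sum_i u i ^+ 2 = 1, \sum_j v j ^+ 2 = 1 &
        \sum_i \sum_j u i * A i j * v j = Num.sqrt l].
Proof.
move=> l0 /eigenvalueP[v vA v0].
pose w := v *m A^T.
have dotE m (s : 'rV[R]_m) : (s *m s^T) 0 0 = \sum_i s 0 i ^+ 2.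
  by rewrite mxE; apply: eq_bigr => i _; rewrite mxE expr2.
pose V := \sum_j v 0 j ^+ 2.
have V0 : 0 < V.
  rewrite lt0r sumr_ge0 ?andbT; last by move=> j _; exact: sqr_ge0.
  apply: contra v0; rewrite psumr_eq0 => [/allP v0|j _]; last exact: sqr_ge0.
  apply/eqP/rowP => j; rewrite mxE; apply/eqP; rewrite -sqrf_eq0.
  by apply: v0; rewrite mem_index_enum.
have wE : \sum_i w 0 i ^+ 2 = l * V.
  by rewrite -dotE trmx_mul trmxK mulmxA -(mulmxA v) vA -scalemxAl mxE dotE.
have wAv : \sum_i \sum_j w 0 i * A i j * v 0 j = l * V.
  rewrite exchange_big /V mulr_sumr; apply: eq_bigr => j _.
  rewrite -mulr_suml (_ : \sum_i _ = (w *m A) 0 j); last by rewrite mxE.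
  by rewrite /w -mulmxA vA mxE expr2 mulrA.
have sV0 : 0 < Num.sqrt V by rewrite sqrtr_gt0.
have sl0 : 0 < Num.sqrt l by rewrite sqrtr_gt0.
have sVE : Num.sqrt V ^+ 2 = V by rewrite sqr_sqrtr// ltW.
have slE : Num.sqrt l ^+ 2 = l by rewrite sqr_sqrtr// ltW.
exists (fun i => w 0 i / (Num.sqrt l * Num.sqrt V)).
exists (fun j => v 0 j / Num.sqrt V); split.
- under eq_bigr do rewrite expr_div_n.
  by rewrite -mulr_suml wE exprMn sVE slE divff// mulf_neq0 ?gt_eqF.
- under eq_bigr do rewrite expr_div_n.
  by rewrite -mulr_suml sVE divff ?gt_eqF.
- transitivity ((\sum_i \sum_j w 0 i * A i j * v 0 j) / (Num.sqrt l * V)).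
    2: by rewrite wAv -{1}slE; field; rewrite !gt_eqF.
  rewrite mulr_suml; apply: eq_bigr => i _.
  rewrite mulr_suml; apply: eq_bigr => j _.
  have -> : (Num.sqrt l * V)^-1 = (Num.sqrt l * Num.sqrt V)^-1 / Num.sqrt V.
    by rewrite -invfM -mulrA -expr2 sVE.
  by ring.
Qed.
End rounding.

(** * Sums over lattice balls *)

Section lattice.
Context (R : realType).

Definition lattice_coord (m n : nat) (z : {ffun 'I_n -> bool * 'I_m})
  (i : 'I_n) : R :=
  signed_nat R ((z i).1, (z i).2 : nat).

(** An integer vector of squared norm at most 4 n has no coordinate beyond 4 n
in absolute value, so that the bound built into the index type loses nothing
([lattice_ball_of_fun]). The zero coordinate has two codes, which can only
increase the sums below. *)
Definition lattice_ball (n : nat) : {set {ffun 'I_n -> bool * 'I_(4 * n).+1}} :=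
  [set z : {ffun 'I_n -> bool * 'I_(4 * n).+1} |
    \sum_i lattice_coord z i ^+ 2 <= 4 * n%:R].

Lemma signed_nat_sqr (k : bool * nat) : signed_nat R k ^+ 2 = (k.2 ^ 2)%:R.
Proof. by rewrite /signed_nat exprMn sqrr_sign mul1r natrX. Qed.

Lemma expR1_ge2 : 2 <= expR 1 :> R.
Proof. by have := expR_ge1Dx (1 : R); lra. Qed.

Lemma sum_expRN_le2 (m : nat) : \sum_(k < m) expR (- k%:R) <= 2 :> R.
Proof.
apply: (@le_trans _ _ (\sum_(k < m) 2^-1 ^+ k)).
  apply: ler_sum => k _; rewrite expRN -[X in expR X]mulr1 expRM_natl -exprVn.
  apply: lerXn2r; rewrite ?nnegrE ?invr_ge0 ?expR_ge0//.
  by rewrite lef_pV2 ?posrE ?expR_gt0// expR1_ge2.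
have -> : \sum_(k < m) 2^-1 ^+ k = 2 - 2 * 2^-1 ^+ m :> R.
  elim: m => [|m IH]; first by rewrite big_ord0 expr0; lra.
  by rewrite big_ord_recr/= IH exprS; lra.
by rewrite lerBlDr lerDl mulr_ge0// exprn_ge0// invr_ge0.
Qed.

(** Each point of the ball satisfies sum |z_i| <= sum z_i^2 <= 4 n, hence has
weight at least 1 for the product weight e^(4 n - sum |z_i|). The total weight
of all vectors factors over the coordinates into e^(4 n) times the n-th power of
a constant at most 4 <= e^2. *)
Lemma card_lattice_ball (n : nat) :
  #|lattice_ball n|%:R <= expR (6 * n%:R) :> R.
Proof.
pose W (k : bool * 'I_(4 * n).+1) : R := expR (- k.2%:R).
apply: (@le_trans _ _ (\sum_(z : {ffun 'I_n -> bool * 'I_(4 * n).+1})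
    expR (4 * n%:R) * \prod_i W (z i))).
  rewrite -sumr_const [leRHS](bigID (mem (lattice_ball n)))/=.
  rewrite -[leLHS]addr0 lerD//; last first.
    apply: sumr_ge0 => z _; rewrite mulr_ge0 ?expR_ge0// prodr_ge0// => i _.
    exact: expR_ge0.
  apply: ler_sum => z; rewrite inE => zB.
  rewrite -expR_sum -expRD -[leLHS]expR0 ler_expR sumrN subr_ge0.
  apply: le_trans zB; apply: ler_sum => i _.
  rewrite /lattice_coord signed_nat_sqr ler_nat /= -mulnn.
  by case: (nat_of_ord _) => // k; rewrite leq_pmulr.
rewrite -mulr_sumr -(bigA_distr_bigA (fun (_ : 'I_n) k => W k))/=.
rewrite prodr_const card_ord.
have -> : 6 * n%:R = 4 * n%:R + 2 * n%:R :> R by lra.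
rewrite expRD ler_wpM2l ?expR_ge0// mulrC expRM_natl.
(* The two signs each contribute a geometric sum at most 2. *)
have W4 : \sum_j W j <= 4.
  rewrite (eq_bigr (fun j => W (j.1, j.2))); last by case.
  rewrite -(pair_bigA _ (fun b k => W (b, k)))/= big_bool.
  by rewrite /W/=; have := sum_expRN_le2 (4 * n).+1; lra.
apply: lerXn2r; rewrite ?nnegrE ?expR_ge0//.
  by apply: sumr_ge0 => j _; exact: expR_ge0.
apply: (le_trans W4); rewrite -[X in expR X]mulr1 expRM_natl expr2.
by have := expR1_ge2; nra.
Qed.

Definition bilinear_form (n p : nat) (A : 'M[R]_(n, p)) (x : 'I_n -> R)
  (y : 'I_p -> R) : R := \sum_i \sum_j x i * A i j * y j.

Definition lattice_exp_sum (n p : nat) (c : R) (A : 'M[R]_(n, p)) : R :=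
  \sum_(z in lattice_ball n) \sum_(t in lattice_ball p)
    expR (c * bilinear_form A (lattice_coord z) (lattice_coord t)).

Lemma lattice_exp_sum_ge (n p : nat) (c : R) (A : 'M[R]_(n, p)) z t :
  z \in lattice_ball n -> t \in lattice_ball p ->
  expR (c * bilinear_form A (lattice_coord z) (lattice_coord t)) <=
  lattice_exp_sum c A.
Proof.
move=> zB tB; rewrite /lattice_exp_sum (bigD1 z)//= (bigD1 t)//=.
rewrite -addrA lerDl addr_ge0//.
  by apply: sumr_ge0 => *; exact: expR_ge0.
by apply: sumr_ge0 => *; apply: sumr_ge0 => *; exact: expR_ge0.
Qed.

Lemma lattice_ball_of_fun (n : nat) (z : 'I_n -> bool * nat) :
    \sum_i signed_nat R (z i) ^+ 2 <= 4 * n%:R ->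
  exists2 z' : {ffun 'I_n -> bool * 'I_(4 * n).+1},
    z' \in lattice_ball n & lattice_coord z' = fun i => signed_nat R (z i).
Proof.
move=> z2; pose z' := [ffun i => ((z i).1, inord (z i).2 : 'I_(4 * n).+1)].
have z'E : lattice_coord z' = fun i => signed_nat R (z i).
  apply/funext => i; rewrite /lattice_coord ffunE/= inordK.
    by case: (z i).
  rewrite ltnS -(ler_nat R) natrM; apply: le_trans z2.
  rewrite (bigD1 i)//= -[leLHS]addr0 lerD//.
    rewrite signed_nat_sqr ler_nat -mulnn.
    by case: (z i).2 => // k; rewrite leq_pmulr.
  by apply: sumr_ge0 => j _; exact: sqr_ge0.
by exists z' => //; rewrite inE z'E.
Qed.

Lemma lattice_exp_sum_ge1 (n p : nat) (c : R) (A : 'M[R]_(n, p)) :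
  1 <= lattice_exp_sum c A.
Proof.
have ball0 m : exists2 z : {ffun 'I_m -> bool * 'I_(4 * m).+1},
    z \in lattice_ball m & lattice_coord z = fun=> 0.
  have [|z zB zE] := @lattice_ball_of_fun m (fun=> (false, 0%N)).
    by rewrite big1 ?mulr_ge0// => i _; rewrite signed_nat_sqr.
  by exists z => //; rewrite zE; apply/funext => i; rewrite /signed_nat mulr0.
have [z zB zE] := ball0 n; have [t tB tE] := ball0 p.
apply: le_trans (lattice_exp_sum_ge c A zB tB).
rewrite /bilinear_form zE big1 ?mulr0 ?expR0// => i _.
by rewrite big1// => j _; rewrite !mul0r.
Qed.

Lemma s_max_ge0 (n p : nat) (A : 'M[R]_(n, p)) : 0 <= s_max A.
Proof.
rewrite /s_max.
have [supA|/sup_out -> //] := pselect (has_sup (singular_values A)).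
have [[_ [l lA _]] bA] := supA.
by apply: le_trans (sqrtr_ge0 l) _; apply: ub_le_sup => //; exists l.
Qed.

Lemma s_max_no_column (n : nat) (A : 'M[R]_(n, 0)) : s_max A = 0.
Proof.
rewrite /s_max (_ : singular_values A = set0) ?sup0// -subset0.
by move=> _ [l /eigenvalueP[v _ /eqP[]]]; rewrite [v]thinmx0.
Qed.

(** The singular value is at most z A t / sqrt (n p) for the rounded singular
vectors z, t, and the exponential of the latter is one of the summands. *)
Lemma expR_s_max_le (n p : nat) (A : 'M[R]_(n, p)) (c : R) : 0 <= c ->
  expR (c * s_max A) <= lattice_exp_sum (c / Num.sqrt (n * p)%:R) A.
Proof.
set Phi := lattice_exp_sum _ _.
have Phi1 : 1 <= Phi by exact: lattice_exp_sum_ge1.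
have Phi0 : 0 < Phi by apply: lt_le_trans Phi1.
rewrite le_eqVlt => /predU1P[<-|c0]; first by rewrite mul0r expR0.
have PhiE : expR (ln Phi) = Phi by rewrite lnK ?posrE.
rewrite -PhiE ler_expR mulrC -ler_pdivlMr//.
rewrite /s_max; have [->|/set0P ne] := eqVneq (singular_values A) set0.
  by rewrite sup0 divr_ge0 ?ln_ge0 // ltW.
apply: ge_sup => // _ [l lA <-].
have [l0|l0] := leP l 0.
  by rewrite ler0_sqrtr// divr_ge0 ?ln_ge0// ltW.
have [u [v [u1 v1 uv]]] := eigenvalue_gram_vectors l0 lA.
have dim_gt0 m (w : 'I_m -> R) : \sum_i w i ^+ 2 = 1 -> 0 < m%:R :> R.
  case: m w => [|m] w; last by rewrite ltr0n.
  by rewrite big_ord0 => /eqP; rewrite eq_sym oner_eq0.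
have n0 := dim_gt0 _ _ u1; have p0 := dim_gt0 _ _ v1.
have scale m (w : 'I_m -> R) : 0 < m%:R :> R -> \sum_i w i ^+ 2 = 1 ->
    \sum_i (Num.sqrt m%:R * w i) ^+ 2 = m%:R.
  move=> m0 w1; under eq_bigr do rewrite exprMn.
  by rewrite -mulr_sumr w1 mulr1 sqr_sqrtr// ltW.
have [z [t [le_zt z2 t2]]] :=
  exists_rounding_bilinear A (scale _ _ n0 u1) (scale _ _ p0 v1).
have [z' zB zE] := lattice_ball_of_fun z2.
have [t' tB tE] := lattice_ball_of_fun t2.
rewrite ler_pdivlMr// -ler_expR PhiE.
apply: le_trans (lattice_exp_sum_ge _ A zB tB); rewrite ler_expR.
have np0 : 0 < Num.sqrt (n * p)%:R :> R by rewrite sqrtr_gt0 natrM mulr_gt0.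
rewrite -mulrA [leLHS]mulrC ler_pM2l// ler_pdivlMl//.
rewrite /bilinear_form zE tE; apply: le_trans le_zt.
rewrite -uv mulr_sumr; apply: ler_sum => i _.
rewrite mulr_sumr; apply: ler_sum => j _.
by rewrite natrM sqrtrM ?ler0n// le_eqVlt; apply/orP; left; apply/eqP; ring.
Qed.

End lattice.

(** * From an exponential moment to powers *)

Section moments.
Context (R : realType) (r : R) (hr : 0 < r).

(** The tangent inequality ln y <= y - 1 at y = x / r. *)
Lemma powR_le_expR (x : R) : 0 <= x -> x `^ r <= r `^ r * expR x.
Proof.
rewrite le_eqVlt => /predU1P[<-|x0].
  by rewrite powR0 ?gt_eqF// mulr_ge0 ?powR_ge0 ?expR_ge0.
have xE : x = r * (x / r) by rewrite mulrC divfK// gt_eqF.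
rewrite {1}xE powRM ?divr_ge0 ?(ltW hr) ?(ltW x0)//.
rewrite ler_wpM2l ?powR_ge0// /powR gt_eqF ?divr_gt0// ler_expR.
have xr : -1 < x / r - 1 by rewrite ltrBrDr addNr divr_gt0.
have := le_ln1Dx xr; rewrite addrC subrK => lnx.
apply: (@le_trans _ _ (r * (x / r - 1))); first by rewrite ler_pM2l.
by rewrite mulrBr mulr1 mulrC divfK ?gt_eqF// lerBlDr lerDl ltW.
Qed.

(** The constant 14 is the exponent rate in the bound exp (14 lam^2) for the
expectation of exp (lam s): with it the second summand on the right has
expectation at most 1. *)
Lemma powR_le_expR_sqr (s lam : R) : 0 <= s -> 1 <= lam ->
  s `^ r <= lam `^ r * (r `^ r * expR 14) *
            (1 + expR (- (14 * lam ^+ 2)) * expR (lam * s)).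
Proof.
move=> s0 lam1; have lam0 : 0 < lam by lra.
have x0 : 0 <= s / lam by rewrite divr_ge0// ltW.
have sE : s = lam * (s / lam) by rewrite mulrC divfK// gt_eqF.
rewrite {1}sE powRM ?(ltW lam0)//.
rewrite -!mulrA ler_wpM2l ?powR_ge0//; apply: le_trans (powR_le_expR x0) _.
rewrite ler_wpM2l ?powR_ge0//.
have -> : expR (s / lam) = expR 14 * expR (s / lam - 14).
  by rewrite -expRD; congr expR; ring.
rewrite ler_wpM2l ?expR_ge0// -expRD.
have -> : - (14 * lam ^+ 2) + lam * s = lam ^+ 2 * (s / lam - 14).
  by field; rewrite gt_eqF.
have [y0|y0] := leP (s / lam - 14) 0.
  rewrite -[leLHS]addr0 lerD ?expR_ge0//.
  by rewrite -[leRHS]expR0 ler_expR.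
rewrite -[leLHS]add0r lerD// ler_expR ler_peMl ?(ltW y0)//.
by rewrite expr_ge1// ltW.
Qed.
End moments.

(** * Exponential moments of a Gaussian matrix *)

Section gaussian_matrix.
Context (R : realType) (d : measure_display) (T : measurableType d).
Context (P : probability T R).
Local Open Scope ereal_scope.

Context (n p : nat) (X : 'I_n -> 'I_p -> {RV P >-> R}).

Lemma expR_bilinear_formE (c : R) (x : 'I_n -> R) (y : 'I_p -> R) (w : T) :
  expR (c * bilinear_form (random_matrix X w) x y) =
  (\prod_(ij : 'I_n * 'I_p) expR (c * x ij.1 * y ij.2 * X ij.1 ij.2 w))%R.
Proof.
rewrite -expR_sum; congr expR; rewrite /bilinear_form.
rewrite pair_bigA/= mulr_sumr; apply: eq_bigr => ij _.
by rewrite mxE; ring.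
Qed.

Lemma measurable_exp_bilinear_form (c : R) (x : 'I_n -> R) (y : 'I_p -> R) :
  measurable_fun [set: T]
    (fun w => expR (c * bilinear_form (random_matrix X w) x y)).
Proof.
under eq_fun do rewrite expR_bilinear_formE.
apply: measurable_prod => ij _; apply: measurableT_comp => //.
exact: measurable_funM.
Qed.

Lemma integral_exp_bilinear_form (c : R) (x : 'I_n -> R) (y : 'I_p -> R) :
    iid_std_normal_entries X ->
  \int[P]_w (expR (c * bilinear_form (random_matrix X w) x y))%:E =
  (expR (c ^+ 2 * (\sum_i x i ^+ 2) * (\sum_j y j ^+ 2) / 2))%:E.
Proof.
move=> [indX lawX].
pose a (ij : 'I_n * 'I_p) : R := (c * x ij.1 * y ij.2)%R.
under eq_integral do rewrite expR_bilinear_formE.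
rewrite (independent_integral_prod (f := fun ij t => expR (a ij * t)%R) indX).
- under eq_bigr do rewrite normal_mgf//.
  rewrite prodEFin -expR_sum; congr (expR _)%:E.
  rewrite -(mulrA (c ^+ 2)%R) big_distrlr/= pair_bigA/= mulr_sumr mulr_suml.
  by apply: eq_bigr => ij _; rewrite /a; ring.
- by move=> ij; apply: measurableT_comp => //; exact: measurable_funM.
- by move=> ij t; exact: expR_ge0.
- by move=> ij; rewrite normal_mgf.
Qed.

Lemma measurable_lattice_exp_sum (c : R) :
  measurable_fun [set: T] (fun w => lattice_exp_sum c (random_matrix X w)).
Proof.
rewrite /lattice_exp_sum; under eq_fun do rewrite -big_enum.
apply: measurable_sum => z; under eq_fun do rewrite -big_enum.
by apply: measurable_sum => t; exact: measurable_exp_bilinear_form.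
Qed.

(** There are at most e^(6 n + 6 p) summands, and each of them is at most
e^(8 lam^2) in expectation, because |z|^2 |t|^2 <= 16 n p. *)
Lemma integral_lattice_exp_sum (lam : R) : iid_std_normal_entries X ->
  \int[P]_w (lattice_exp_sum (lam / Num.sqrt (n * p)%:R)
               (random_matrix X w))%:E <=
  (expR (8 * lam ^+ 2 + 6 * n%:R + 6 * p%:R))%:E.
Proof.
move=> iidX; set c := (lam / _)%R.
pose E (z : {ffun 'I_n -> bool * 'I_(4 * n).+1})
  (t : {ffun 'I_p -> bool * 'I_(4 * p).+1}) :=
  \int[P]_w (expR (c * bilinear_form (random_matrix X w)
    (lattice_coord R z) (lattice_coord R t)))%:E.
have E_le z t : z \in lattice_ball R n -> t \in lattice_ball R p ->
    E z t <= (expR (8 * lam ^+ 2))%:E.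
  rewrite !inE => z2 t2; rewrite /E (integral_exp_bilinear_form _ _ _ iidX).
  rewrite lee_fin ler_expR.
  set a := (\sum_i _)%R in z2 *; set b := (\sum_i _)%R in t2 *.
  have a0 : (0 <= a)%R by apply: sumr_ge0 => i _; exact: sqr_ge0.
  have b0 : (0 <= b)%R by apply: sumr_ge0 => i _; exact: sqr_ge0.
  have c2 : (c ^+ 2 * (n%:R * p%:R) <= lam ^+ 2)%R.
    rewrite /c expr_div_n sqr_sqrtr ?ler0n// -natrM.
    have [->|np0] := eqVneq (n * p)%N 0%N; first by rewrite mulr0 sqr_ge0.
    by rewrite divfK// pnatr_eq0.
  have ab : (a * b <= (4 * n%:R) * (4 * p%:R))%R by apply: ler_pM.
  have := ler_wpM2l (sqr_ge0 c) ab; lra.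
have intE : \int[P]_w (lattice_exp_sum c (random_matrix X w))%:E =
    \sum_(z in lattice_ball R n) \sum_(t in lattice_ball R p) E z t.
  under eq_integral do rewrite -sumEFin -big_enum.
  rewrite ge0_integral_sum//.
  - rewrite big_enum; apply: eq_bigr => z _.
    under eq_integral do rewrite -sumEFin -big_enum.
    rewrite ge0_integral_sum//; first by rewrite big_enum.
    + by move=> t; apply/measurable_EFinP; exact: measurable_exp_bilinear_form.
  - move=> z; apply/measurable_EFinP; under eq_fun do rewrite -big_enum.
    by apply: measurable_sum => t; exact: measurable_exp_bilinear_form.
  - by move=> z w _; rewrite lee_fin sumr_ge0// => t _; exact: expR_ge0.
rewrite intE.
apply: (@le_trans _ _ (\sum_(z in lattice_ball R n)
    \sum_(t in lattice_ball R p) (expR (8 * lam ^+ 2))%:E)).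
  by apply: lee_sum => z zB; apply: lee_sum => t tB; exact: E_le.
under eq_bigr do rewrite sumEFin sumr_const.
rewrite sumEFin sumr_const lee_fin -mulrnA -[leLHS]mulr_natr natrM.
rewrite -addrA 2!expRD ler_wpM2l ?expR_ge0// mulrC.
by apply: ler_pM => //; exact: card_lattice_ball.
Qed.

(** The factor a stands inside the expectation, where it is absorbed into the
measurable bound on s_max; linearity of the integral applies to that bound. *)
Lemma expectation_s_max_powR_le (r a : R) :
    iid_std_normal_entries X -> (0 < r)%R -> (0 <= a)%R ->
  'E_P[(fun w => (a * s_max (random_matrix X w)) `^ r)%R] <=
  (2 * (r `^ r * expR 14) * (a * Num.sqrt (n%:R + p%:R)) `^ r)%:E.
Proof.
move=> iidX r0 a0; rewrite unlock.
(* For p > 0 one has lam >= 1; for n = p = 0 one has lam = 0. *)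
have [p0|p0] := posnP p.
  rewrite integral0_eq ?lee_fin ?mulr_ge0 ?powR_ge0 ?expR_ge0//.
  move=> w _; move: (random_matrix X w); rewrite p0 => A.
  by rewrite s_max_no_column mulr0 powR0 ?gt_eqF.
set lam := Num.sqrt (n%:R + p%:R)%R.
have lam2 : (lam ^+ 2 = n%:R + p%:R)%R by rewrite sqr_sqrtr// addr_ge0.
have lam1 : (1 <= lam)%R.
  rewrite -[leLHS]sqrtr1 ler_sqrt ?addr_ge0//.
  by rewrite -natrD ler1n addn_gt0 p0 orbT.
pose Phi w := lattice_exp_sum (lam / Num.sqrt (n * p)%:R) (random_matrix X w).
pose K := ((a * lam) `^ r * (r `^ r * expR 14))%R.
pose e := expR (- (14 * lam ^+ 2)).
have K0 : (0 <= K)%R by rewrite !mulr_ge0 ?powR_ge0 ?expR_ge0.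
have e0 : (0 <= e)%R by exact: expR_ge0.
have Phi0 w : (0 <= Phi w)%R by apply: le_trans (lattice_exp_sum_ge1 _ _).
have mPhi : measurable_fun [set: T] (EFin \o Phi).
  by apply/measurable_EFinP; exact: measurable_lattice_exp_sum.
apply: (@le_trans _ _ (\int[P]_w (K%:E * (1 + e%:E * (Phi w)%:E)))).
  apply: ge0_le_integral_nonmeasurable => w.
    by rewrite lee_fin powR_ge0.
  rewrite lee_fin powRM ?s_max_ge0// /K powRM ?sqrtr_ge0//.
  rewrite -!mulrA ler_wpM2l ?powR_ge0//.
  apply: le_trans (powR_le_expR_sqr r0 (s_max_ge0 _) lam1) _.
  rewrite -!mulrA; do 3 rewrite ler_wpM2l ?powR_ge0 ?expR_ge0//.
  rewrite lerD2l ler_wpM2l//.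
  by apply: expR_s_max_le; apply: le_trans lam1.
rewrite ge0_integralZl//; last 2 first.
- by apply: emeasurable_funD => //; exact: emeasurable_funM.
- by move=> w _; rewrite adde_ge0// mule_ge0// lee_fin.
rewrite ge0_integralD//; last 2 first.
- by move=> w _; rewrite mule_ge0// lee_fin.
- exact: emeasurable_funM.
rewrite integral_cst//= probability_setT mule1 ge0_integralZl//; last first.
  by move=> w _; rewrite lee_fin.
have PhiE : e%:E * \int[P]_w (Phi w)%:E <= 1.
  apply: (@le_trans _ _ (e%:E * (expR (14 * lam ^+ 2))%:E)).
    rewrite lee_wpmul2l ?lee_fin//.
    apply: le_trans (integral_lattice_exp_sum lam iidX) _.
    by rewrite lee_fin ler_expR lam2; lra.
  by rewrite -EFinM -expRD addNr expR0.
apply: (@le_trans _ _ (K%:E * (1 + 1))).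
  by rewrite lee_wpmul2l ?lee_fin// leeD2l.
by rewrite -EFinD -EFinM lee_fin /K; lra.
Qed.
End gaussian_matrix.

(** * The moment bounds *)

Theorem lemma2p2 (R : realType) (r : R) (hr : 0 < r) :
  (exists c1 c2 : R, [/\ 0 < c1, 0 < c2 &
    forall (d : measure_display) (T : measurableType d) (P : probability T R)
      (n p : nat) (X : 'I_n -> 'I_p -> {RV P >-> R}),
      iid_std_normal_entries X ->
      ('E_P[(fun w => s_max (random_matrix X w) `^ r)%R] <=
        (c1 * (Num.sqrt n%:R + Num.sqrt p%:R) `^ r + c2)%:E)%E]) /\
  (forall gamma : R, 0 <= gamma ->
    exists K3 : R, 0 < K3 /\
    forall p : nat -> nat,
      (fun n : nat => (p n)%:R / n%:R : R) @ \oo --> gamma ->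
      \forall n \near \oo,
        forall (d : measure_display) (T : measurableType d)
          (P : probability T R) (X : 'I_n -> 'I_(p n) -> {RV P >-> R}),
          iid_std_normal_entries X ->
          ('E_P[(fun w =>
             (s_max (random_matrix X w) / Num.sqrt n%:R) `^ r)%R] <=
            K3%:E)%E).
Proof.
pose c := 2 * (r `^ r * expR 14).
have c0 : 0 < c by rewrite !mulr_gt0 ?powR_gt0 ?expR_gt0.
split.
  exists c, 1; split => // d T P n p X iidX.
  have := expectation_s_max_powR_le iidX hr ler01.
  under [X in 'E_P[X]%E]eq_fun do rewrite mul1r.
  move=> /le_trans; apply; rewrite lee_fin mul1r -/c.
  rewrite -[leLHS]addr0 lerD// ler_wpM2l ?(ltW c0)//.
  apply: ge0_ler_powR; rewrite ?nnegrE ?addr_ge0 ?sqrtr_ge0 ?(ltW hr)//.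
  have s0 : 0 <= Num.sqrt n%:R + Num.sqrt p%:R :> R.
    by rewrite addr_ge0 ?sqrtr_ge0.
  rewrite -[leRHS](ger0_norm s0) -sqrtr_sqr ler_wsqrtr//.
  rewrite sqrrD !sqr_sqrtr ?ler0n// addrAC lerDl.
  by rewrite mulrn_wge0// mulr_ge0 ?sqrtr_ge0.
move=> gamma gamma0.
exists (c * Num.sqrt (gamma + 2) `^ r); split.
  by rewrite mulr_gt0// powR_gt0// sqrtr_gt0; lra.
move=> p /cvgrPdist_le/(_ 1 ltr01) p_gamma.
near=> n => d T P X iidX.
have n0 : (0 < n)%N by near: n; exists 1%N.
have nR0 : 0 < n%:R :> R by rewrite ltr0n.
have pn : (p n)%:R / n%:R <= gamma + 1.
  suff : `|gamma - (p n)%:R / n%:R| <= 1 by rewrite ler_norml; lra.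
  by near: n.
have a0 : 0 <= (Num.sqrt n%:R)^-1 :> R by rewrite invr_ge0 sqrtr_ge0.
have := expectation_s_max_powR_le iidX hr a0.
under [X in 'E_P[X]%E]eq_fun do rewrite mulrC.
move=> /le_trans; apply; rewrite lee_fin -/c ler_wpM2l ?(ltW c0)//.
apply: ge0_ler_powR; rewrite ?nnegrE ?mulr_ge0 ?sqrtr_ge0 ?(ltW hr)//.
rewrite -sqrtrV ?ler0n// -sqrtrM ?invr_ge0 ?ler0n//; apply: ler_wsqrtr.
rewrite mulrDr mulVf ?gt_eqF// mulrC; lra.
Unshelve. all: by end_near.
Qed.
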